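(* Let $0\le r\le d$, let $\mathcal{S}\subseteq\mathbb{R}^m$ be a convex set, and let $\boldsymbol{s}(t)$ be a clamped B-spline curve of degree $d$ with control points $\boldsymbol{P}_0,\dots,\boldsymbol{P}_N\in\mathbb{R}^m$, with $r$-th derivative $\boldsymbol{s}^{(r)}(t)$ and $r$-th order virtual control points $\boldsymbol{P}^{(r)}_0,\dots,\boldsymbol{P}^{(r)}_{N+r}$. (1) If $\boldsymbol{P}^{(r)}_j\in\mathcal{S}$ for all $j=r,\dots,N$, then $\boldsymbol{s}^{(r)}(t)\in\mathcal{S}$ for all $t\in[\tau_0,\tau_v)$. (2) If, for some $i\in\{d,\dots,N\}$, $\boldsymbol{P}^{(r)}_j\in\mathcal{S}$ for all $j=i-d+r,\dots,i$, then $\boldsymbol{s}^{(r)}(t)\in\mathcal{S}$ for all $t\in[\tau_i,\tau_{i+1})$.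
   Context: Fix integers $d\ge 1$, $N\ge d$, $v=N+d+1$, and a knot vector $\tau_0\le\tau_1\le\dots\le\tau_v$ with $\tau_0<\tau_v$ that is clamped ($\tau_0=\dots=\tau_d$ and $\tau_{v-d}=\dots=\tau_v$) and uniform ($\tau_{d+1}-\tau_d=\dots=\tau_{N+1}-\tau_N$). B-spline basis functions are defined recursively by $\lambda_{i,0}(t)=1$ if $\tau_i\le t<\tau_{i+1}$ and $0$ otherwise, and $$\lambda_{i,k}(t)=\frac{t-\tau_i}{\tau_{i+k}-\tau_i}\lambda_{i,k-1}(t)+\frac{\tau_{i+k+1}-t}{\tau_{i+k+1}-\tau_{i+1}}\lambda_{i+1,k-1}(t),$$ where a term with zero denominator is taken to be $0$. For $0\le r\le d$ put $\boldsymbol{\Lambda}_{d-r}(t)=(\lambda_{0,d-r}(t),\dots,\lambda_{N+r,d-r}(t))^T$. Given control points $\boldsymbol{P}_0,\dots,\boldsymbol{P}_N\in\mathbb{R}^m$ and $P=[\boldsymbol{P}_0\ \cdots\ \boldsymbol{P}_N]\in\mathbb{R}^{m\times(N+1)}$, the B-spline curve of degree $d$ and its $r$-th order derivative are given by $\boldsymbol{s}^{(r)}(t)=PB_r\boldsymbol{\Lambda}_{d-r}(t)$, with $\boldsymbol{s}=\boldsymbol{s}^{(0)}$. Here $B_r=M_{d,d-r}C_r\in\mathbb{R}^{(N+1)\times(N+r+1)}$, where: $M_{d,d}=I_{N+1}$ and, for $1\le r\le d$, $M_{d,d-r}=F_1F_2\cdots F_r$, with $F_i\in\mathbb{R}^{(N-i+2)\times(N-i+1)}$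 having, in its column number $k+1$ ($k=0,\dots,N-i$), the entry $-a_k$ in row $k+1$, the entry $a_k$ in row $k+2$, and zeros elsewhere, $a_k=\frac{d-i+1}{\tau_{k+d+1}-\tau_{k+i}}$; and $C_r=[\,0_{(N+1-r)\times r}\ \ I_{N+1-r}\ \ 0_{(N+1-r)\times r}\,]$ (with $C_0=I_{N+1}$). The $r$-th order virtual control points of $\boldsymbol{s}^{(r)}$ are the columns $\boldsymbol{P}^{(r)}_0,\dots,\boldsymbol{P}^{(r)}_{N+r}$ of $P^{(r)}=PB_r$. *)

(* Defs.v *)
From HB Require Import structures.
From mathcomp Require Import all_boot all_order all_algebra.
From mathcomp Require Import boolp classical_sets reals convex.

Set Implicit Arguments.
Unset Strict Implicit.
Unset Printing Implicit Defensive.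

Import Order.TTheory GRing.Theory Num.Theory.
Local Open Scope ring_scope.

(* A knot vector tau_0, ..., tau_v with v = N + d + 1 is represented by a
   function nat -> R of which only the values at 0, ..., v are ever used. *)
Record clamped_uniform_knots (R : realType) (d N : nat) (tau : nat -> R) :
    Prop := ClampedUniformKnots {
  knots_mono : forall i j : nat,
    (i <= j <= N + d + 1)%N -> tau i <= tau j;
  knots_nondegenerate : tau 0%N < tau (N + d + 1)%N;
  knots_clamped_left : forall i : nat, (i <= d)%N -> tau i = tau 0%N;
  knots_clamped_right : forall i : nat,
    (N + 1 <= i <= N + d + 1)%N -> tau i = tau (N + d + 1)%N;
  knots_uniform : forall i : nat,
    (d <= i <= N)%N -> tau i.+1 - tau i = tau d.+1 - tau d
}.

(* [bspline_basis tau k i t] is lambda_{i,k}(t); since x / 0 = 0 in a field of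
   the library, the terms with zero denominator vanish as they should. *)
Fixpoint bspline_basis (R : realType) (tau : nat -> R) (k i : nat) (t : R) :
    R :=
  match k with
  | 0%N => if tau i <= t < tau i.+1 then 1 else 0
  | k'.+1 =>
      (t - tau i) / (tau (i + k)%N - tau i) * bspline_basis tau k' i t
      + (tau (i + k + 1)%N - t) / (tau (i + k + 1)%N - tau i.+1)
        * bspline_basis tau k' i.+1 t
  end.

(* [basis_vector d N tau r t] is Lambda_{d-r}(t). *)
Definition basis_vector (R : realType) (d N : nat) (tau : nat -> R) (r : nat)
    (t : R) : 'cV[R]_(N + r + 1) :=
  \col_(i < N + r + 1) bspline_basis tau (d - r) i t.

(* The factor F_i, for 1 <= i <= d <= N; its size is
   (N - i + 2) x (N - i + 1).  Rows and columns are numbered from 0 here. *)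
Definition diff_factor (R : realType) (d N : nat) (tau : nat -> R) (i : nat) :
    'M[R]_(N.+2 - i, N.+1 - i) :=
  \matrix_(p < N.+2 - i, k < N.+1 - i)
    let a := (d - i + 1)%:R / (tau (k + d + 1)%N - tau (k + i)%N) in
    if p == k :> nat then - a else if p == k.+1 :> nat then a else 0.

(* M_{d,d-r} = F_1 F_2 ... F_r.  The product typechecks because N.+2 - r.+1
   and N.+1 - r are convertible. *)
Fixpoint diff_matrix (R : realType) (d N : nat) (tau : nat -> R) (r : nat) :
    'M[R]_(N.+1, N.+1 - r) :=
  match r with
  | 0%N => 1%:M
  | r'.+1 => diff_matrix d N tau r' *m diff_factor d N tau r'.+1
  end.

(* C_r = [0 I 0] with an identity block of size N + 1 - r starting at column
   number r; it is given entrywise to avoid a cast from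
   r + (N + 1 - r) + r columns to N + r + 1 columns. *)
Definition padding_matrix (R : realType) (N r : nat) :
    'M[R]_(N.+1 - r, N + r + 1) :=
  \matrix_(p < N.+1 - r, q < N + r + 1)
    if q == (r + p)%N :> nat then 1 else 0.

(* B_r = M_{d,d-r} C_r *)
Definition deriv_matrix (R : realType) (d N : nat) (tau : nat -> R) (r : nat) :
    'M[R]_(N.+1, N + r + 1) :=
  diff_matrix d N tau r *m padding_matrix R N r.

(* The control points P_0, ..., P_N are the columns of P. *)
Definition virtual_control_matrix (R : realType) (m d N : nat)
    (tau : nat -> R) (P : 'M[R]_(m, N.+1)) (r : nat) : 'M[R]_(m, N + r + 1) :=
  P *m deriv_matrix d N tau r.

Definition virtual_control_point (R : realType) (m d N : nat)
    (tau : nat -> R) (P : 'M[R]_(m, N.+1)) (r : nat) (j : 'I_(N + r + 1)) :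
    'cV[R]_m :=
  col j (virtual_control_matrix d tau P r).

(* s^(r)(t), by its closed formula P B_r Lambda_{d-r}(t): at a knot where the
   classical derivative fails to exist this is the value from the right.  The
   curve s itself is the case r = 0. *)
Definition bspline_curve_deriv (R : realType) (m d N : nat) (tau : nat -> R)
    (P : 'M[R]_(m, N.+1)) (r : nat) (t : R) : 'cV[R]_m :=
  P *m deriv_matrix d N tau r *m basis_vector d N tau r t.

(* Main.v *)
Require Import Defs.
From HB Require Import structures.
From mathcomp Require Import all_boot all_order all_algebra.
From mathcomp Require Import boolp classical_sets reals convex.
From mathcomp Require Import interval_inference zify ring lra.

Import Order.TTheory GRing.Theory Num.Theory.
Local Open Scope ring_scope.

(** On the knot span [tau_i, tau_{i+1}) the B-splines of degree d - r that do
    not vanish are those of index i - (d - r), ..., i; they are nonnegative and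
    add up to 1, so s^(r)(t) is a convex combination of the virtual control
    points with these indices.  Clampedness places every t in [tau_0, tau_v) in
    a span with d <= i <= N, which reduces (1) to (2). *)

(** Convexity only handles two points, so the points are merged one at a time. Partial sums have
    weight below 1 in general, hence each is tracked as its total weight times a point of [S]. *)
Lemma convex_set_sum (R : realFieldType) (M : lmodType R) (S : set M)
    (I : finType) (w : I -> R) (f : I -> M) :
  convex_set S -> (forall i, 0 <= w i) -> \sum_i w i = 1 ->
  (forall i, w i != 0 -> f i \in S) -> \sum_i w i *: f i \in S.
Proof.
move=> cS w_ge0 w1 fS.
(* The empty partial sum is [0 *: y0], which requires [S] to be inhabited; weights adding up to 1
   cannot all vanish. *)
have [y0 y0S] : exists y, y \in S.
  have [i wi0 | w_eq0] := pickP (fun i => w i != 0).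
    by exists (f i); exact: fS.
  have /eqP := w1; rewrite big1 ?(eq_sym 0) ?oner_eq0// => i _.
  by apply/eqP; have /negbFE := w_eq0 i.
have sumS (s : seq I) :
    exists2 y, y \in S & \sum_(i <- s) w i *: f i = (\sum_(i <- s) w i) *: y.
  elim: s => [|i s [y yS IHs]]; first by exists y0; rewrite // !big_nil scale0r.
  rewrite !big_cons IHs; have [-> | wi_neq0] := eqVneq (w i) 0.
    by exists y; rewrite // scale0r !add0r.
  set W := \sum_(j <- s) w j.
  have W_ge0 : 0 <= W by exact: sumr_ge0.
  have wi_gt0 : 0 < w i by rewrite lt0r wi_neq0 w_ge0.
  have wW_gt0 : 0 < w i + W by exact: ltr_pwDl.
  have k_ge0 : 0 <= w i / (w i + W) by rewrite divr_ge0// ltW.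
  have k_le1 : w i / (w i + W) <= 1 by rewrite ler_pdivrMr// mul1r lerDl.
  exists ((w i / (w i + W)) *: f i + (1 - w i / (w i + W)) *: y).
    exact: (cS (f i) y (Itv01 k_ge0 k_le1) (fS _ wi_neq0) yS).
  rewrite scalerDr !scalerA mulrBr mulr1 mulrCA divff ?gt_eqF// mulr1.
  by rewrite addrAC subrr add0r.
have [y yS ->] := sumS (index_enum I).
by rewrite w1 scale1r.
Qed.

Section Basis.
Variables (R : realType) (tau : nat -> R) (n : nat).
Hypothesis tau_mono : forall i j : nat, (i <= j <= n)%N -> tau i <= tau j.
Implicit Types (i j k : nat) (t : R).

Lemma bspline_basis_local k j t :
  (j + k < n)%N -> t < tau j \/ tau (j + k).+1 <= t ->
  bspline_basis tau k j t = 0.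
Proof.
elim: k j => [|k IHk] j /= jkn tout.
  rewrite addn0 in tout; case: ifP => // /andP[? ?]; case: tout; lra.
have m1 : tau j <= tau j.+1 by apply: tau_mono; lia.
have m2 : tau (j + k).+1 <= tau (j + k).+2 by apply: tau_mono; lia.
rewrite addnS in tout.
rewrite !IHk ?mulr0 ?addr0 //; try lia; rewrite ?addSn; case: tout; lra.
Qed.

(** The coefficients in the recursion can be negative off the support, so locality disposes of that
    case first. *)
Lemma bspline_basis_ge0 k j t : (j + k < n)%N -> 0 <= bspline_basis tau k j t.
Proof.
elim: k j => [|k IHk] j jkn; first by rewrite /=; case: ifP.
have [tj | jt] := ltP t (tau j); first by rewrite bspline_basis_local//; left.
have [kt | tk] := leP (tau (j + k.+1).+1) t.
  by rewrite bspline_basis_local//; right.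
have m1 : tau j <= tau (j + k.+1)%N by apply: tau_mono; lia.
have m2 : tau j.+1 <= tau (j + k.+1).+1 by apply: tau_mono; lia.
rewrite /= addn1 addr_ge0// mulr_ge0 ?divr_ge0 ?IHk ?subr_ge0 ?(ltW tk)//; lia.
Qed.

(** Partition of unity, by induction on the degree. Starting the sum at 0 instead of [i - k] only
    adds vanishing terms. *)
Lemma sum_bspline_basis k i t :
  (k <= i)%N -> (i + k < n)%N -> tau i <= t < tau i.+1 ->
  \sum_(j < i.+1) bspline_basis tau k j t = 1.
Proof.
elim: k => [|k IHk] ki ikn /andP[it ti].
  rewrite big_ord_recr /= it ti big1 ?add0r// => j _.
  have : tau j.+1 <= tau i by apply: tau_mono; have := ltn_ord j; lia.
  by case: ifP => // /andP[]; lra.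
pose w j := (t - tau j) / (tau (j + k.+1)%N - tau j) * bspline_basis tau k j t.
(* The weights of lambda_{j+1,k} in lambda_{j,k+1} and lambda_{j+1,k+1} add up
   to 1 (where it is nonzero), so that the sum telescopes. *)
have recE j : (j <= i)%N -> bspline_basis tau k.+1 j t =
    (w j - w j.+1) + bspline_basis tau k j.+1 t.
  move=> ji; rewrite /= -/(w j) -addrA; congr (_ + _).
  rewrite addn1 /w addSn.
  (* If the common denominator is 0, both weights are 0, but then lambda_{j+1,k} has an empty
     support and vanishes at [t]. *)
  have [D0 | D_neq0] := eqVneq (tau (j + k.+1).+1 - tau j.+1) 0; last by field.
  rewrite bspline_basis_local ?mulr0 ?addr0 ?oppr0 ?add0r// ?addSn; first lia.
  have [jlt|ltj] := ltnP j i; last by left; have -> : j = i by lia.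
  have [ij|?] := leqP (j + k).+2 i.
    by right; apply: le_trans it; apply: tau_mono; lia.
  have : tau i.+1 <= tau (j + k).+2 by apply: tau_mono; lia.
  have : tau j.+1 <= tau i by apply: tau_mono; lia.
  by move: D0; rewrite addnS; lra.
rewrite (eq_bigr (fun j : 'I_i.+1 => (w j - w j.+1)
  + bspline_basis tau k j.+1 t)); last by move=> j _; rewrite recE // -ltnS.
(* These two values kill the ends [w 0] and [w i.+1] of the telescoping sum, and allow the remaining
   sum over 1, ..., i+1 to be shifted to 0, ..., i. *)
have basisi0 : bspline_basis tau k i.+1 t = 0.
  by rewrite bspline_basis_local//; [lia | left].
have basis00 : bspline_basis tau k 0 t = 0.
  rewrite bspline_basis_local//; first lia.
  by right; apply: le_trans it; apply: tau_mono; lia.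
rewrite big_split /= -(big_mkord xpredT (fun j => w j - w j.+1)).
under eq_bigr do rewrite -opprB.
rewrite sumrN telescope_sumr// /w basisi0 basis00 !mulr0 subrr oppr0 add0r.
rewrite -[LHS]add0r -[X in X + _]basis00.
rewrite -(big_ord_recl i.+1 (fun j : 'I_i.+2 => bspline_basis tau k j t)).
rewrite big_ord_recr /= basisi0 addr0.
by apply: IHk; [lia | lia | rewrite it].
Qed.

(** Descending from [b], the first index whose knot is at most [t] works; repeated knots are thereby
    skipped. *)
Lemma knot_span (a b : nat) t : (a <= b)%N -> tau a <= t < tau b ->
  exists2 i, (a <= i < b)%N & tau i <= t < tau i.+1.
Proof.
elim: b => [|b IHb] ab /andP[ta tb].
  by move: ab ta; rewrite leqn0 => /eqP -> ?; lra.
have [{}ab|ba] := leqP a b; last first.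
  by move: ta; have -> : a = b.+1 by [lia]; lra.
have [tb'|bt] := ltP t (tau b); last by exists b; rewrite ?bt ?tb//; lia.
by have [|i ?] := IHb ab; [rewrite ta | exists i => //; lia].
Qed.
End Basis.

Lemma bspline_curve_deriv_sum (R : realType) (m d N r : nat) (tau : nat -> R)
    (P : 'M[R]_(m, N.+1)) (t : R) :
  bspline_curve_deriv d tau P r t =
  \sum_(j < N + r + 1) bspline_basis tau (d - r) j t
    *: virtual_control_point d tau P j.
Proof.
apply/matrixP => a b; rewrite mxE summxE; apply: eq_bigr => j _.
by rewrite !mxE mulrC.
Qed.

Theorem proposition1 (R : realType) (m d N r : nat) (tau : nat -> R)
    (S : set 'cV[R]_m) (P : 'M[R]_(m, N.+1))
    (hd : (1 <= d)%N) (hN : (d <= N)%N) (hr : (r <= d)%N)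
    (htau : clamped_uniform_knots d N tau)
    (hS : convex_set S) :
  ((forall j : 'I_(N + r + 1), (r <= j <= N)%N ->
      virtual_control_point d tau P j \in S) ->
   forall t : R, tau 0%N <= t < tau (N + d + 1)%N ->
     bspline_curve_deriv d tau P r t \in S)
  /\
  (forall i : nat, (d <= i <= N)%N ->
    (forall j : 'I_(N + r + 1), (i - d + r <= j <= i)%N ->
      virtual_control_point d tau P j \in S) ->
    forall t : R, tau i <= t < tau i.+1 ->
      bspline_curve_deriv d tau P r t \in S).
Proof.
have mono := knots_mono htau.
have part2 i : (d <= i <= N)%N ->
    (forall j : 'I_(N + r + 1), (i - d + r <= j <= i)%N ->
      virtual_control_point d tau P j \in S) ->
    forall t : R, tau i <= t < tau i.+1 ->
      bspline_curve_deriv d tau P r t \in S.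
  move=> diN PS t /andP[it ti].
  have basis0 (j : nat) : (j < N + r + 1)%N ->
      ~~ (i - d + r <= j <= i)%N -> bspline_basis tau (d - r) j t = 0.
    move=> jN jout; apply: (bspline_basis_local _ _ _ mono); first lia.
    (* Either the support starts at or after tau_{i+1}, or it ends at or before tau_i. *)
    have [ij|ji] := ltnP i j.
      by left; apply: (lt_le_trans ti); apply: mono; lia.
    by right; apply: le_trans it; apply: mono; lia.
  rewrite bspline_curve_deriv_sum; apply: convex_set_sum => //.
  - by move=> j; apply: (bspline_basis_ge0 _ _ _ mono); have := ltn_ord j; lia.
  (* The partition of unity stops at index [i]; the later basis functions vanish at [t]. *)
  - have iN : (i.+1 <= N + r + 1)%N by lia.
    rewrite -(@sum_bspline_basis _ _ _ mono (d - r) i t) ?it//; try lia.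
    rewrite (big_ord_widen _ (fun j => bspline_basis tau (d - r) j t) iN).
    rewrite [RHS]big_mkcond; apply: eq_bigr => j _; case: ifP => // ji.
    by apply: basis0 => //; lia.
  - by move=> j wj; apply: PS; apply: contraNT wj => jout; rewrite basis0.
split=> // PS t /andP[t0 tv].
have [||i iN it] := @knot_span _ tau d N.+1 t; first lia.
  rewrite (knots_clamped_left htau)// t0 /=.
  by rewrite (knots_clamped_right htau)//; lia.
apply: (part2 i) => //.
(* As [d <= i <= N], the window from [i - d + r] to [i] lies within [r], ..., [N]. *)
by move=> j ij; apply: PS; lia.
Qed.
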